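(* Let $\sigma>0$. For all $\epsilon>0$ and $\delta>0$ there exists $n_0$ such that for every integer $n\ge n_0$ the following holds: if $x^{(n)}$ is a sample drawn from $X^{(n)}\sim\mathcal{N}(\mathbf{0},\sigma^2\mathbf{I}_n)$, then with probability at least $1-\delta$, $$n\sigma^2(1-2\epsilon) < \|x^{(n)}\|_2^2 < n\sigma^2(1+2\epsilon).$$
   Context: $\mathcal{N}(\mathbf{0},\sigma^2\mathbf{I}_n)$ is the centered Gaussian distribution on $\mathbb{R}^n$ with covariance $\sigma^2$ times the $n\times n$ identity matrix; $\|\cdot\|_2$ is the Euclidean norm. *)

(* Defs.v *)
From HB Require Import structures.
From mathcomp Require Import all_boot all_order all_algebra.
From mathcomp Require Import all_classical all_reals all_analysis.
Set Implicit Arguments.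
Unset Strict Implicit.
Unset Printing Implicit Defensive.
Import Order.TTheory GRing.Theory Num.Theory.
Import numFieldNormedType.Exports.

Local Open Scope classical_set_scope.
Local Open Scope ring_scope.

(* The sigma-algebra that the library puts on tuples is the one generated by
   the coordinates, here the Borel sigma-algebra of R^n. *)
Notation euclidean R n := (n.-tuple (measurableTypeR R)).

Definition coord (R : realType) (n : nat) (x : euclidean R n) : 'cV[R]_n :=
  \col_i tnth x i.

Definition l2norm (R : realType) (n : nat) (x : euclidean R n) : R :=
  Num.sqrt (\sum_(i < n) tnth x i ^+ 2).

Definition cons_euclidean (R : realType) (n : nat)
    (p : measurableTypeR R * euclidean R n) : euclidean R n.+1 :=
  [tuple of p.1 :: p.2].

Lemma measurable_cons_euclidean (R : realType) (n : nat) :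
  measurable_fun [set: measurableTypeR R * euclidean R n]
    (@cons_euclidean R n).
Proof. exact: measurable_cons. Qed.

Section lebesgue_step.
Context (R : realType) (n : nat).
Variable m : {sigma_finite_measure set (euclidean R n) -> \bar R}.
Local Open Scope ereal_scope.

Definition lebesgue_step : set (euclidean R n.+1) -> \bar R :=
  pushforward (@lebesgue_measure R \x m) (@cons_euclidean R n).

Let lebesgue_step0 : lebesgue_step set0 = 0.
Proof. by rewrite /lebesgue_step /pushforward preimage_set0 measure0. Qed.

Let lebesgue_step_ge0 A : 0 <= lebesgue_step A.
Proof. by rewrite /lebesgue_step /pushforward measure_ge0. Qed.

Let measurable_cons_preimage (A : set (euclidean R n.+1)) :
  measurable A -> measurable (@cons_euclidean R n @^-1` A).
Proof.
by move=> mA; rewrite -[X in measurable X]setTI;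
  exact: measurable_cons_euclidean.
Qed.

Let lebesgue_step_sigma_additive : semi_sigma_additive lebesgue_step.
Proof.
move=> F mF tF mUF; rewrite /lebesgue_step /pushforward preimage_bigcup.
apply: measure_semi_sigma_additive.
- by move=> k; exact: measurable_cons_preimage.
- apply/trivIsetP => /= i j _ _ ij; rewrite -preimage_setI.
  by move/trivIsetP : tF => /(_ _ _ _ _ ij) ->//; rewrite preimage_set0.
- by rewrite -preimage_bigcup; exact: measurable_cons_preimage.
Qed.

HB.instance Definition _ := isMeasure.Build _ _ _ lebesgue_step
  lebesgue_step0 lebesgue_step_ge0 lebesgue_step_sigma_additive.

Let lebesgue_step_sigma_finite : sigma_finite [set: _] lebesgue_step.
Proof.
have /sigma_finiteP[F [TF ndF Foo]] := sigma_finiteT (@lebesgue_measure R).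
have /sigma_finiteP[G [TG ndG Goo]] := sigma_finiteT m.
pose uncons (x : euclidean R n.+1) : measurableTypeR R * euclidean R n :=
  (thead x, [tuple of behead x]).
have consK : cancel (@cons_euclidean R n) uncons.
  by move=> [a x]; rewrite /uncons theadE; congr pair; exact: val_inj.
have munc : measurable_fun [set: euclidean R n.+1] uncons.
  apply/measurable_fun_pair; last exact: measurable_behead.
  exact: measurable_tnth.
exists (fun k => uncons @^-1` (F k `*` G k)).
  rewrite -preimage_bigcup (_ : \bigcup_k _ = setT) ?preimage_setT//.
  rewrite -setXTT TF TG predeqE => -[x y]; split.
    by move=> [k _ []/= ? ?]; split; exists k.
  move=> [/= [k _ Fkx] [l _ Gly]]; exists (maxn k l) => //; split.
  - by move: x Fkx; exact/subsetPset/ndF/leq_maxl.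
  - by move: y Gly; exact/subsetPset/ndG/leq_maxr.
move=> k; have [mFk Fk] := Foo k; have [mGk Gk] := Goo k; split.
  by rewrite -[X in measurable X]setTI; apply: munc => //; exact: measurableX.
rewrite /lebesgue_step /pushforward -comp_preimage.
rewrite (_ : _ \o _ = id) ?preimage_id; last first.
  by apply/funext => p /=; rewrite consK.
by rewrite product_measure1E// lte_mul_pinfty// ge0_fin_numE.
Qed.

HB.instance Definition _ := Measure_isSigmaFinite.Build _ _ _ lebesgue_step
  lebesgue_step_sigma_finite.
End lebesgue_step.

Fixpoint lebesgue_measure_n (R : realType) (n : nat) :
    {sigma_finite_measure set (euclidean R n) -> \bar R} :=
  if n is k.+1 then lebesgue_step (lebesgue_measure_n R k)
  else \d_([tuple] : euclidean R 0).

(* The density of N(mu, Sigma); meaningful for Sigma positive definite. *)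
Definition gaussian_pdf (R : realType) (n : nat) (mu : 'cV[R]_n)
    (Sigma : 'M[R]_n) (x : euclidean R n) : R :=
  let y := coord x - mu in
  (Num.sqrt (\det ((pi *+ 2) *: Sigma)))^-1 *
  expR (- (y^T *m invmx Sigma *m y) ord0 ord0 / 2).

Definition gaussian_prob (R : realType) (n : nat) (mu : 'cV[R]_n)
    (Sigma : 'M[R]_n) (A : set (euclidean R n)) : \bar R :=
  (\int[lebesgue_measure_n R n]_(x in A) (gaussian_pdf mu Sigma x)%:E)%E.

Definition is_gaussian d (T : measurableType d) (R : realType)
    (P : probability T R) (n : nat) (X : {mfun T >-> euclidean R n})
    (mu : 'cV[R]_n) (Sigma : 'M[R]_n) : Prop :=
  forall A : set (euclidean R n), measurable A ->
    distribution P X A = gaussian_prob mu Sigma A.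

(* Main.v *)
(** Chernoff's bound by a change of measure.  The ratio of the densities of
N(0, s^2 I) and N(0, tau^2 I) at x is
(tau / s)^n exp (- |x|^2 (s^-2 - tau^-2) / 2), so on a set where
n c <= |x|^2 (s^-2 - tau^-2) the probability under N(0, s^2 I) is at most
((tau / s) exp (- c / 2))^n.  Taking tau^2 = s^2 / (1 - a), the events
|x|^2 >= n s^2 (1 + 2 eps) (with a > 0) and |x|^2 <= n s^2 (1 - 2 eps)
(with a < 0) both have exponentially small probability. *)
Require Import Defs.
From mathcomp Require Import all_boot all_order all_algebra.
From mathcomp Require Import all_classical all_reals all_analysis.
From mathcomp Require Import measurable_realfun ring lra.
Set Implicit Arguments.
Unset Strict Implicit.
Unset Printing Implicit Defensive.
Import Order.TTheory GRing.Theory Num.Theory.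
Import numFieldNormedType.Exports.
Local Open Scope classical_set_scope.
Local Open Scope ring_scope.

Lemma measurable_prod_tnth (R : realType) (n : nat) (f : R -> R) :
  measurable_fun [set: R] f ->
  measurable_fun [set: euclidean R n] (fun x => \prod_(i < n) f (tnth x i)).
Proof.
move=> mf; apply: measurable_prod => i _.
by apply: measurableT_comp => //; exact: measurable_tnth.
Qed.

(** By induction on [n]: [lebesgue_measure_n] in dimension [n.+1] is the image of a product measure
    under [cons_euclidean], so Tonelli splits off the factor of the first coordinate. In dimension 0
    a Dirac mass integrates the empty product. *)
Lemma integral_prod_tnth (R : realType) (n : nat) (f : R -> R) :
  measurable_fun [set: R] f -> (forall t, 0 <= f t) ->
  (\int[@lebesgue_measure R]_t (f t)%:E)%E = 1%E ->
  (\int[lebesgue_measure_n R n]_x (\prod_(i < n) f (tnth x i))%:E)%E = 1%E.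
Proof.
move=> mf f0 f1; elim: n => [|n IHn].
  rewrite integral_dirac//=; last first.
    by apply/measurable_EFinP; exact: measurable_prod_tnth.
  by rewrite diracT mul1e big_ord0.
have mp := measurable_prod_tnth (n := n.+1) mf.
rewrite /= ge0_integral_pushforward//=; last 3 first.
- exact: measurable_cons_euclidean.
- exact/measurable_EFinP.
- by move=> x _; rewrite lee_fin prodr_ge0.
rewrite preimage_setT fubini_tonelli1/=; last 2 first.
- apply/measurable_EFinP; apply: (measurableT_comp mp).
  exact: measurable_cons_euclidean.
- by move=> x; rewrite lee_fin prodr_ge0.
rewrite -[RHS]f1; apply: eq_integral => t _; rewrite /fubini_F /=.
transitivity ((f t)%:E *
    \int[lebesgue_measure_n R n]_x (\prod_(i < n) f (tnth x i))%:E)%E.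
  rewrite -ge0_integralZl_EFin//=; last 2 first.
  - by move=> x _; rewrite lee_fin prodr_ge0.
  - by apply/measurable_EFinP; exact: measurable_prod_tnth.
  apply: eq_integral => x _; rewrite -EFinM big_ord_recl; congr (_ * _)%:E.
  by apply: eq_bigr => i _; rewrite tnthS.
by rewrite IHn mule1.
Qed.

Lemma normal_pdf0E (R : realType) (s t : R) : 0 < s ->
  normal_pdf 0 s t =
  (Num.sqrt (pi *+ 2) * s)^-1 * expR (- (t ^+ 2 / s ^+ 2) / 2).
Proof.
move=> s0; rewrite normal_pdfE ?gt_eqF// /normal_peak /normal_fun subr0.
congr (_^-1 * expR _); last by field; rewrite gt_eqF.
by rewrite -mulrnAr sqrtrM ?sqr_ge0// sqrtr_sqr gtr0_norm// mulrC.
Qed.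

Lemma sqrtr_exprn (R : rcfType) (a : R) (n : nat) : 0 <= a ->
  Num.sqrt (a ^+ n) = Num.sqrt a ^+ n.
Proof.
move=> a0; elim: n => [|n IHn]; first by rewrite !expr0 sqrtr1.
by rewrite !exprS sqrtrM// IHn.
Qed.

(** For a scalar covariance matrix the determinant is a power and the quadratic form a multiple of
    the sum of squares, so the density factors over the coordinates. *)
Lemma gaussian_pdf_isotropic (R : realType) (n : nat) (s : R)
    (x : euclidean R n) : 0 < s ->
  gaussian_pdf 0 (s ^+ 2)%:M x = \prod_(i < n) normal_pdf 0 s (tnth x i).
Proof.
move=> s0; under eq_bigr do rewrite normal_pdf0E//.
rewrite big_split/= prodr_const card_ord -expR_sum /gaussian_pdf subr0.
rewrite scale_scalar_mx det_scalar invmx_scalar; congr (_ * expR _).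
  (* Writing [s] as the root of [s ^+ 2] merges both factors of the normalizing constant into one
     square root, as in the determinant. *)
  rewrite exprVn -[in RHS](ger0_norm (ltW s0)) -sqrtr_sqr -sqrtrM.
    by rewrite sqrtr_exprn// mulr_ge0 ?sqr_ge0// mulrn_wge0// pi_ge0.
  by rewrite mulrn_wge0// pi_ge0.
rewrite mul_mx_scalar -scalemxAl !mxE mulr_sumr -sumrN mulr_suml.
by apply: eq_bigr => i _; rewrite !mxE; field; rewrite gt_eqF.
Qed.

Lemma normal_pdf_ratio (R : realType) (s tau t : R) : 0 < s -> 0 < tau ->
  normal_pdf 0 s t =
  tau / s * expR (- (t ^+ 2 * (s ^- 2 - tau ^- 2)) / 2) * normal_pdf 0 tau t.
Proof.
move=> s0 tau0; rewrite !normal_pdf0E// mulrACA -expRD.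
have k0 : Num.sqrt (pi *+ 2) != 0 :> R.
  by rewrite gt_eqF// sqrtr_gt0 mulrn_wgt0 ?pi_gt0.
by congr (_ * expR _); field; rewrite ?k0 ?gt_eqF.
Qed.

(** Multiplying [normal_pdf_ratio] over the coordinates bounds the density on [A] by [rho ^+ n]
    times the density with deviation [tau], whose integral over the whole space is 1. *)
Lemma gaussian_prob_le_tilt (R : realType) (n : nat) (s tau c : R)
    (A : set (euclidean R n)) : 0 < s -> 0 < tau -> measurable A ->
  (forall x, A x ->
    n%:R * c <= (\sum_(i < n) tnth x i ^+ 2) * (s ^- 2 - tau ^- 2)) ->
  (gaussian_prob 0 (s ^+ 2)%:M A <= ((tau / s * expR (- c / 2)) ^+ n)%:E)%E.
Proof.
move=> s0 tau0 mA Ac; set rho := tau / s * expR (- c / 2).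
have rho0 : 0 <= rho by rewrite mulr_ge0 ?expR_ge0 ?divr_ge0 ?ltW.
pose p r (x : euclidean R n) := \prod_(i < n) normal_pdf 0 r (tnth x i).
have p0 r x : 0 <= p r x by rewrite prodr_ge0// => i _; exact: normal_pdf_ge0.
have mp r D : measurable_fun D (EFin \o p r).
  apply/measurable_EFinP; apply: measurable_funTS; apply: measurable_prod_tnth.
  exact: measurable_normal_pdf.
have mrp D : measurable_fun D (fun x => (rho ^+ n)%:E * (p tau x)%:E)%E.
  by apply: measurable_funeM; exact: mp.
have rp0 x : (0 <= (rho ^+ n)%:E * (p tau x)%:E)%E.
  by rewrite -EFinM lee_fin mulr_ge0 ?exprn_ge0.
rewrite /gaussian_prob.
under eq_integral do rewrite gaussian_pdf_isotropic//.
apply: (@le_trans _ _ (\int[lebesgue_measure_n R n]_(x in A)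
    ((rho ^+ n)%:E * (p tau x)%:E))%E).
  apply: ge0_le_integral => //.
  - by move=> x _; rewrite lee_fin p0.
  - exact: mp.
  move=> x /Ac xc; rewrite -EFinM lee_fin.
  under eq_bigr do rewrite (normal_pdf_ratio _ s0 tau0).
  rewrite 2!big_split/= ler_wpM2r//; first exact: p0.
  rewrite /rho exprMn prodr_const card_ord -expR_sum -expRM_natl.
  rewrite ler_wpM2l//; first by rewrite exprn_ge0// divr_ge0 ?ltW.
  rewrite ler_expR -mulr_suml sumrN -mulr_suml mulrA mulrN !mulNr lerN2.
  by rewrite ler_pM2r.
apply: (@le_trans _ _ (\int[lebesgue_measure_n R n]_x
    ((rho ^+ n)%:E * (p tau x)%:E))%E).
  by apply: ge0_subset_integral => //; exact: subsetT.
rewrite ge0_integralZl_EFin//; last 3 first.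
- by move=> x _; rewrite lee_fin p0.
- exact: mp.
- exact: exprn_ge0.
rewrite integral_prod_tnth ?mule1//.
- exact: measurable_normal_pdf.
- by move=> t; exact: normal_pdf_ge0.
- exact: integral_normal_pdf.
Qed.

(** The factor [a] on both sides of the condition on [A] makes it an upper tail for [a > 0] and a
    lower tail for [a < 0]. The last numerical hypothesis says [(1 - a) * (1 + a * b) > 1]. Since
    [rho] is chosen before [n], the decay is geometric. *)
Lemma gaussian_prob_chernoff (R : realType) (s a b : R) : 0 < s ->
  a < 1 -> 0 < 1 + a * b -> 0 < a * (b - 1 - a * b) ->
  exists2 rho : R, 0 <= rho < 1 &
  forall (n : nat) (A : set (euclidean R n)), measurable A ->
  (forall x, A x ->
    a * (n%:R * s ^+ 2 * b) <= a * \sum_(i < n) tnth x i ^+ 2) ->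
  (gaussian_prob 0 (s ^+ 2)%:M A <= (rho ^+ n)%:E)%E.
Proof.
move=> s0 a1 ab0 gap; have a1_gt0 : 0 < 1 - a by rewrite subr_gt0.
pose tau := s / Num.sqrt (1 - a).
have q0 : 0 < Num.sqrt (1 - a) by rewrite sqrtr_gt0.
have tau0 : 0 < tau by rewrite divr_gt0.
have tausE : tau / s = (Num.sqrt (1 - a))^-1.
  by rewrite /tau; field; rewrite !gt_eqF.
set rho := tau / s * expR (- (a * b) / 2).
have rho0 : 0 <= rho by rewrite mulr_ge0 ?expR_ge0// divr_ge0 ?ltW.
exists rho.
  (* Squared, [rho < 1] reads [expR (- (a * b)) < 1 - a], and
     [expR (a * b) >= 1 + a * b]. *)
  rewrite rho0 /= -(@ltr_pXn2r _ 2) ?nnegrE// /rho.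
  rewrite exprMn tausE exprVn sqr_sqrtr ?(ltW a1_gt0)// -expRM_natl expr1n.
  rewrite mulrC ltr_pdivrMr// mul1r mulrC divfK//.
  rewrite expRN -[ltLHS]mul1r ltr_pdivrMr ?expR_gt0//.
  apply: lt_le_trans (ler_wpM2l (ltW a1_gt0) (expR_ge1Dx _)).
  lra.
move=> n A mA Ab; apply: gaussian_prob_le_tilt => // x /Ab xb.
have -> : s ^- 2 - tau ^- 2 = a / s ^+ 2.
  rewrite /tau expr_div_n sqr_sqrtr ?(ltW a1_gt0)//.
  by field; rewrite !gt_eqF.
rewrite [leRHS]mulrA ler_pdivlMr ?exprn_gt0// [leRHS]mulrC; apply: le_trans xb.
by rewrite le_eqVlt; apply/orP; left; apply/eqP; ring.
Qed.

Lemma exprn_eventually_le (R : realType) (r e : R) : 0 <= r < 1 -> 0 < e ->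
  exists N : nat, forall n, (N <= n)%N -> r ^+ n <= e.
Proof.
move=> /andP[r0 r1] e0.
have nr1 : `|r| < 1 by rewrite ger0_norm.
have /cvgrPdist_le/(_ _ e0)[N _ Nr] := cvg_geometric 1 nr1.
exists N => n /Nr; rewrite /= sub0r normrN mul1r.
by rewrite ger0_norm ?exprn_ge0.
Qed.

Theorem theorem3p6 (R : realType) (sigma : R) (sigma_gt0 : 0 < sigma) :
  forall eps delta : R, 0 < eps -> 0 < delta ->
  exists n0 : nat, forall n : nat, (n0 <= n)%N ->
  forall (d : measure_display) (T : measurableType d) (P : probability T R)
    (X : {mfun T >-> euclidean R n}),
  is_gaussian P X 0 (sigma ^+ 2)%:M ->
  ((1 - delta)%:E <=
   P [set w | (n%:R * sigma ^+ 2 * (1 - 2 * eps) < l2norm (X w) ^+ 2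
              < n%:R * sigma ^+ 2 * (1 + 2 * eps))%R])%E.
Proof.
move=> eps delta e0 d0.
have k0 : 0 < 1 + 2 * eps by lra.
(* For [b = 1 + 2 * eps] this value maximizes [a * (b - 1 - a * b)], a quadratic in [a] with roots 0
   and [(b - 1) / b]. *)
pose a := eps / (1 + 2 * eps).
have aE : a * (1 + 2 * eps) = eps by rewrite /a divfK// gt_eqF.
have a0 : 0 < a by rewrite divr_gt0.
have [||||r1 r1_01 H1] :=
  @gaussian_prob_chernoff R sigma a (1 + 2 * eps) => //.
- by rewrite ltr_pdivrMr//; lra.
- by rewrite aE; lra.
- by rewrite aE mulr_gt0//; lra.
(* Here [1 + a * b] is [1 - eps + 2 * eps ^+ 2], which has negative discriminant, and the gap is
   [eps ^+ 2 * (1 + 2 * eps)]; both are positive even if [1 - 2 * eps <= 0]. *)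
have [||||r2 r2_01 H2] :=
  @gaussian_prob_chernoff R sigma (- eps) (1 - 2 * eps) => //.
- lra.
- nra.
- nra.
have d20 : 0 < delta / 2 by lra.
have [N1 HN1] := exprn_eventually_le r1_01 d20.
have [N2 HN2] := exprn_eventually_le r2_01 d20.
exists (maxn N1 N2) => n; rewrite geq_max => /andP[/HN1 n1 /HN2 n2] d T P X gX.
set lo := _ * (1 - _); set hi := _ * (1 + _).
pose N (x : euclidean R n) := \sum_(i < n) tnth x i ^+ 2.
have mN : measurable_fun [set: euclidean R n] N.
  apply: measurable_sum => i; apply: measurable_funX.
  exact: measurable_tnth.
pose B1 := [set x | hi <= N x].
pose B2 := [set x | N x <= lo].
have mB1 : measurable B1.
  by rewrite -[B1]setTI; exact: measurable_fun_le.
have mB2 : measurable B2.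
  by rewrite -[B2]setTI; exact: measurable_fun_le.
have mX A : measurable A -> measurable (X @^-1` A).
  by move=> mA; rewrite -[X in measurable X]setTI; exact: (measurable_funPT X).
(* Passing to the complement turns the claim into a union bound over the two closed tails, each of
   probability at most [delta / 2]. *)
have -> : [set w | lo < l2norm (X w) ^+ 2 < hi] =
    ~` (X @^-1` B1 `|` X @^-1` B2).
  apply/seteqP; split => w /=.
    rewrite sqr_sqrtr ?sumr_ge0// => [/andP[lw wh] [|]|i _]; last exact: sqr_ge0.
      by rewrite /B1 /= leNgt wh.
    by rewrite /B2 /= leNgt lw.
  rewrite sqr_sqrtr ?sumr_ge0// => [/not_orP[/negP + /negP]|i _];
    last exact: sqr_ge0.
  by rewrite -!ltNge => -> ->.
rewrite probability_setC; last by apply: measurableU; exact: mX.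
rewrite EFinB leeB// (_ : delta = delta / 2 + delta / 2); last by lra.
apply: le_trans (measureU2 _ (mX _ mB1) (mX _ mB2)) _.
rewrite EFinD leeD//.
- rewrite -[leLHS]/(distribution P X B1) gX//.
  apply: le_trans (H1 n B1 mB1 _) _.
    by move=> x; rewrite ler_pM2l.
  by rewrite lee_fin.
- rewrite -[leLHS]/(distribution P X B2) gX//.
  apply: le_trans (H2 n B2 mB2 _) _.
    by move=> x; rewrite ler_nM2l// oppr_lt0.
  by rewrite lee_fin.
Qed.
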